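(* Let $A,B\subseteq\mathbb{Z}$ be finite sets with $|A|=2$ and $|B|\ge 2$. Then $|A\widehat{+}B|=|A|+|B|-3$ if and only if $A=B$.
   Context: For finite sets $A,B\subseteq\mathbb{Z}$, the restricted sumset is $A\widehat{+}B=\{a+b: a\in A,\ b\in B,\ a\neq b\}$. A pair $(A,B)$ with $|A|,|B|\ge 2$ satisfying $|A\widehat{+}B|=|A|+|B|-3$ is called a critical pair; the paper states the theorem as ''$(A,B)$ is a critical pair if and only if $A=B$'', where throughout the paper all sets considered have at least two elements. *)

(* Defs.v *)
From mathcomp Require Import all_boot all_algebra finmap.

Set Implicit Arguments.
Unset Strict Implicit.
Unset Printing Implicit Defensive.

Definition restricted_sumset (A B : {fset int}) : {fset int} :=
  [fset (a + b)%R | a in A, b in B & a != b]%fset.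

(* Main.v *)
(** If the restricted sumset has [#|B| - 1] elements, then each [a] in [A] lies
    in [B] and the translate [a + (B \ a)] already fills the sumset, so for
    [A = {x < y}] one gets [x + (B \ x) = y + (B \ y)].  Hence [B] is stable
    under [b |-> b + (y - x)] except at [y], and under [b |-> b - (y - x)]
    except at [x]: the maximum of [B] is [y], its minimum is [x], and any
    other element would be translated out of the interval from [x] to [y]. *)

Require Import Defs.
From mathcomp Require Import all_boot all_order all_algebra finmap.
From mathcomp Require Import zify.

Import Order.TTheory GRing.Theory Num.Theory.

Local Open Scope fset_scope.

(** Taking [f] to be the identity or negation gives a maximum or a minimum of a nonempty set. *)
Lemma fset_argmax (f : int -> int) (B : {fset int}) (b0 : int) :
  b0 \in B -> exists2 m, m \in B & forall b, b \in B -> (f b <= f m)%R.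
Proof.
move=> b0B; case: (@Order.TotalTheory.arg_maxP _ _ B [` b0B] xpredT (f \o val) isT).
by move=> m _ max_m; exists (val m) => [|b bB]; [exact: valP | exact: (max_m [` bB])].
Qed.

Lemma cardfs2_lt (A : {fset int}) :
  #|` A| = 2 -> exists x y : int, (x < y)%R /\ A = [fset x; y].
Proof.
move=> A2; have /fset0Pn[x xA] : A != fset0 by rewrite -cardfs_gt0 A2.
have := cardfsD1 x A; rewrite A2 xA => -[] /esym/eqP/cardfs1P[y Dy].
have neq_yx : y != x by have := fset11 y; rewrite -Dy !inE => /andP[].
have -> : A = [fset x; y] by rewrite -(fsetD1K xA) Dy.
have [lt_xy|lt_yx|eq_xy] := ltgtP x y.
- by exists x, y.
- by exists y, x; rewrite fsetUC.
- by rewrite eq_xy eqxx in neq_yx.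
Qed.

Lemma translate_sub_sumset (A B : {fset int}) (a : int) : a \in A ->
  [fset (a + b)%R | b in B `\ a] `<=` restricted_sumset A B.
Proof.
move=> aA; apply/fsubsetP => _ /imfsetP[b /= /[!inE] /andP[neq_ba bB] ->].
by apply/imfset2P; exists a => //; exists b => //; rewrite !inE bB eq_sym.
Qed.

Lemma card_translate (C : {fset int}) (a : int) :
  #|` [fset (a + b)%R | b in C]| = #|` C|.
Proof. by rewrite card_imfset //; exact: addrI. Qed.

Lemma critical_translate (A B : {fset int}) (a : int) :
    a \in A -> 0 < #|` B| -> #|` restricted_sumset A B| = #|` B|.-1 ->
  a \in B /\ [fset (a + b)%R | b in B `\ a] = restricted_sumset A B.
Proof.
move=> aA B_gt0 cardS; have subS := @translate_sub_sumset A B a aA.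
have cardB := cardfsD1 a B.
(* Were [a] outside [B], the translate would keep all |B| elements, too many for a set of size |B| -
   1; [B_gt0] makes this strict. *)
have aB : a \in B.
  have := fsubset_leq_card subS; rewrite card_translate cardS.
  by case: (a \in B) cardB => //; lia.
split=> //; apply/eqP; rewrite eqEfcard subS card_translate cardS.
by rewrite cardB aB add1n leqnn.
Qed.

Lemma eq_translates_fset2 (B : {fset int}) (x y : int) :
    (x < y)%R -> x \in B -> y \in B ->
    [fset (x + b)%R | b in B `\ x] = [fset (y + b)%R | b in B `\ y] ->
  B = [fset x; y].
Proof.
move=> lt_xy xB yB eq_xy.
(* By [eq_xy], [y + b] equals [x + c] for some [c] in [B], and this [c] is the shifted element. *)
have up b : b \in B -> b != y -> (b + (y - x))%R \in B.
  move=> bB neq_by.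
  have : (y + b)%R \in [fset (x + b)%R | b in B `\ x].
    by rewrite eq_xy; apply/imfsetP; exists b; rewrite //= !inE neq_by.
  case/imfsetP=> c /= /[!inE] /andP[_ cB] Ec.
  by have -> : (b + (y - x))%R = c by lia.
have down b : b \in B -> b != x -> (b - (y - x))%R \in B.
  move=> bB neq_bx.
  have : (x + b)%R \in [fset (y + b)%R | b in B `\ y].
    by rewrite -eq_xy; apply/imfsetP; exists b; rewrite //= !inE neq_bx.
  case/imfsetP=> c /= /[!inE] /andP[_ cB] Ec.
  by have -> : (b - (y - x))%R = c by lia.
have le_y b : b \in B -> (b <= y)%R.
  (* A maximum other than [y] would be moved by [up] to a larger element of [B]. *)
  have [m mB max_m] := fset_argmax id B y yB.
  have [<-|neq_my] := eqVneq m y; first exact: max_m.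
  by have /= := max_m _ (up m mB neq_my); lia.
have ge_x b : b \in B -> (x <= b)%R.
  (* Maximising [- b] gives the minimum; if it were not [x], [down] would produce a smaller
     element. *)
  have [m mB min_m] := fset_argmax (fun b => - b)%R B x xB.
  have [<-|neq_mx] := eqVneq m x; first by move=> /min_m /=; lia.
  by have /= := min_m _ (down m mB neq_mx); lia.
apply/fsetP => b; rewrite !inE; apply/idP/orP => [bB|[] /eqP-> //].
have [|neq_by] := eqVneq b y; [by right | left].
(* From [b + (y - x) <= y] follows [b <= x], hence [b = x]. *)
by have := le_y _ (up b bB neq_by); have := ge_x b bB; lia.
Qed.

(** Only the pairs (x, y) and (y, x) have distinct entries, and their sums agree by
    commutativity. *)
Lemma restricted_sumset_fset2 (x y : int) : x != y ->
  restricted_sumset [fset x; y] [fset x; y] = [fset (x + y)%R].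
Proof.
move=> neq_xy; apply/fsetP => z; rewrite inE; apply/imfset2P/eqP.
  case=> a /= /[!inE] /orP[] /eqP-> [b /= /[!inE] /andP[/orP[] /eqP-> ]];
    by rewrite ?eqxx // addrC.
by move=> ->; exists x; rewrite ?inE ?eqxx //; exists y; rewrite ?inE ?eqxx ?orbT.
Qed.

Theorem theorem1 (A B : {fset int}) (hA : #|` A| = 2) (hB : 2 <= #|` B|) :
  #|` restricted_sumset A B| = #|` A| + #|` B| - 3 <-> A = B.
Proof.
have [x [y [lt_xy DA]]] := cardfs2_lt A hA.
split=> [cardS|<-]; last first.
  by rewrite hA DA restricted_sumset_fset2 ?cardfs1 // lt_eqF.
have B_gt0 : 0 < #|` B| by exact: ltnW.
have {}cardS : #|` restricted_sumset A B| = #|` B|.-1 by rewrite cardS hA; lia.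
have xA : x \in A by rewrite DA !inE eqxx.
have yA : y \in A by rewrite DA !inE eqxx orbT.
have [xB Sx] := critical_translate A B x xA B_gt0 cardS.
have [yB Sy] := critical_translate A B y yA B_gt0 cardS.
by rewrite DA [RHS](eq_translates_fset2 B x y) // Sx Sy.
Qed.
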